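(* Let $X$ be a finite dimensional real Banach space, let $a,b>0$, and let $N\subset X$ be an $(a,b)$-net of $X$ (with the metric induced by the norm). Then $N$ has a $K$-retractional basis, where $$K=\Big(\frac{2b}{a}+1\Big)\Big(\frac{4b}{a}+1\Big)\Big(\frac{156b}{a}+2\Big).$$
   Context: $\mathbb N=\{1,2,\dots\}$. A subset $N$ of a metric space $(M,d)$ is an $(a,b)$-net of $M$ if it is $a$-separated ($d(x,y)\ge a$ for all distinct $x,y\in N$) and $b$-dense (for every $x\in M$ there is $y\in N$ with $d(x,y)\le b$). Let $M$ be a countable metric space and $K\ge 1$. A $K$-retractional basis of $M$ is a sequence of retractions $\varphi_n:M\to M$, $n\in\mathbb N$, for which there are points $x_1,x_2,\dots\in M$ such that: (1) $\varphi_n(M)=\{x_1,\dots,x_n\}$ for every $n$ (and $\varphi_n$ restricts to the identity on this set); (2) $\bigcup_{j\ge1}\{x_j\}=M$; (3) every $\varphi_n$ is $K$-Lipschitz; (4) $\varphi_m\circ\varphi_n=\varphi_{\min(m,n)}$ for all $m,n\in\mathbb N$. *)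

(* Defs.v *)
From HB Require Import structures.
From mathcomp Require Import all_boot all_order all_algebra.
From mathcomp Require Import all_classical all_reals all_analysis.

Set Implicit Arguments.
Unset Strict Implicit.
Unset Printing Implicit Defensive.

Import Order.TTheory GRing.Theory Num.Theory.
Import numFieldNormedType.Exports.

Local Open Scope classical_set_scope.
Local Open Scope ring_scope.

#[short(type="finDimBanachType")]
HB.structure Definition FinDimBanach (R : realType) :=
  {X of CompleteNormedModule R X & Vector R X}.

Section NormMetric.
Context {R : realType} (X : finDimBanachType R).

Let norm_dist (x y : X) : R := `|x - y|.

Let norm_dist_ge0 x y : 0 <= norm_dist x y.
Proof. exact: normr_ge0. Qed.

Let norm_dist_positivity x y : norm_dist x y = 0 -> x = y.
Proof. by move=> /eqP; rewrite normr_eq0 subr_eq0 => /eqP. Qed.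

Let ball_norm_dist (x : X) (r : R) : ball x r = [set y | norm_dist x y < r].
Proof. by rewrite -ball_normE. Qed.

HB.instance Definition _ := PseudoMetric_isMetric.Build R X
  norm_dist_ge0 norm_dist_positivity ball_norm_dist.

End NormMetric.

Section SubspaceMetric.
Context {R : realType} {M : metricType R} (A : set M).

Let sub_dist (x y : A) : R := mdist (set_val x) (set_val y).

Let sub_dist_ge0 x y : 0 <= sub_dist x y.
Proof. exact: mdist_ge0. Qed.

Let sub_dist_positivity x y : sub_dist x y = 0 -> x = y.
Proof. by move=> /mdist_positivity /val_inj. Qed.

Let ball_sub_dist (x : A) (r : R) : ball x r = [set y | sub_dist x y < r].
Proof. by rewrite /ball/= /initial_ball ballEmdist. Qed.

HB.instance Definition _ := PseudoMetric_isMetric.Build R (set_type A)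
  sub_dist_ge0 sub_dist_positivity ball_sub_dist.

End SubspaceMetric.

Definition is_net {R : realType} {M : metricType R} (a b : R) (N : set M) :=
  (forall x y, N x -> N y -> x <> y -> a <= mdist x y) /\
  (forall x, exists2 y, N y & mdist x y <= b).

(* Continuity is not required here: it follows from the Lipschitz condition
   in retractional_basis. *)
Definition retraction_onto {T : Type} (f : T -> T) (A : set T) :=
  range f = A /\ (forall x, A x -> f x = x).

(* The library's k.-lipschitz is restricted to maps between normed modules. *)
Definition klipschitz {R : realType} {M : metricType R} (K : R) (f : M -> M) :=
  forall x y, mdist (f x) (f y) <= K * mdist x y.

(* Indices start at 0: phi n and x n stand for $\varphi_{n+1}$ and $x_{n+1}$,
   hence the image of phi n is {x 0, ..., x n}. The points x j need not be
   pairwise distinct, so that finite spaces are allowed. *)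
Definition retractional_basis {R : realType} {M : metricType R} (K : R)
    (phi : nat -> M -> M) :=
  exists x : nat -> M,
  [/\ forall n, retraction_onto (phi n) (x @` `I_n.+1),
      \bigcup_j [set x j] = [set: M],
      forall n, klipschitz K (phi n) &
      forall m n, phi m \o phi n = phi (minn m n)].

(* The notion is only defined for countable M and K >= 1. *)
Definition has_retractional_basis {R : realType} (M : metricType R) (K : R) :=
  [/\ countable [set: M], 1 <= K &
      exists phi : nat -> M -> M, retractional_basis K phi].

(* Main.v *)
Require Import Defs.
From HB Require Import structures.
From mathcomp Require Import all_boot all_order all_algebra finmap.
From mathcomp Require Import all_classical all_reals all_analysis.
From mathcomp Require Import zify ring lra.

Import Order.TTheory GRing.Theory Num.Theory.
Import numFieldNormedType.Exports.

Local Open Scope classical_set_scope.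
Local Open Scope ring_scope.

(* Put h = 3b. A rooted tree structure on N, with finite levels, yields
   commuting retractions: enumerate N so that lower levels come first and let
   phi_n send a point to its first ancestor among x_1, ..., x_n. These maps are
   Lipschitz with a dimension-free constant as soon as the ancestors of x stay
   within bounded distance of the segment from x to 0, because the radial
   retractions onto balls are 2-Lipschitz and N is a-separated.

   Rounding a ray to N at every step would let errors accumulate, so ancestors
   follow dyadically many rays: in the shell 2^k h <= |v| < 2^(k+1) h they are
   roundings of the points j h z, with z in a maximal 2^-k-separated set of unit
   vectors. Such points are at least h > 2b apart, hence distinct ones round to
   distinct points of N. Entering the next inner shell changes the direction by
   less than 2^-k, so the directions drift by at most 2 * 2^-k in total and the
   positions by at most 4h. *)

(** * Compactness in finite dimension *)

(** [m] is the minimum of [|f v|] over the compact unit sphere, positive because [f] vanishes only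
    at 0; homogeneity carries the bound to all vectors. *)
Lemma rV_norm_lower_bound (R : realType) (V : normedModType R) n
    (f : 'rV[R]_n -> V) : (forall k v, f (k *: v) = k *: f v) ->
  (forall v, f v = 0 -> v = 0) -> continuous f ->
  exists2 m : R, 0 < m & forall v, m * `|v| <= `|f v|.
Proof.
move=> fZ f0 cf.
pose S : set 'rV[R]_n := [set v | `|v| = 1].
have normS v : v != 0 -> S (`|v|^-1 *: v).
  move=> v0; rewrite /S/= normrZ normfV normr_id mulVf//.
  by rewrite normr_eq0.
(* An empty sphere means that 0 is the only vector, and then any [m] works. *)
have [S0|/set0P/negP/negPn/eqP S0] := pselect (S !=set0); last first.
  exists 1 => // v; have [->|/normS] := eqVneq v 0; last by rewrite S0.
  by rewrite normr0 mulr0.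
have cS : compact S.
  apply: bounded_closed_compact.
    by exists 1; split => // M M1 v; rewrite /S/= => ->; exact: ltW.
  have -> : S = (fun v : 'rV[R]_n => `|v|) @^-1` [set 1] by [].
  by apply: closed_comp => [v _|]; [exact: norm_continuous|exact: closed_eq].
have cnf : continuous (fun v => `|f v|).
  by move=> v; apply: continuous_comp; [exact: cf|exact: norm_continuous].
have [c cS1 cmin] := compact_EVT_min S0 cS (continuous_subspaceT cnf).
have fc0 : 0 < `|f c|.
  rewrite normr_gt0; apply/eqP => /f0 c0; move: cS1.
  by rewrite inE /S/= c0 normr0 => /eqP; rewrite eq_sym oner_eq0.
exists `|f c| => // v; have [->|v0] := eqVneq v 0.
  by rewrite normr0 mulr0.
have := cmin (`|v|^-1 *: v); rewrite inE => /(_ (normS _ v0)).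
by rewrite fZ normrZ normfV normr_id mulrC ler_pdivlMr ?normr_gt0.
Qed.

(** In coordinates with respect to a basis, the lower bound puts the ball of radius [r] inside the
    image of the compact coordinate ball of radius [r / m]. *)
Lemma closed_ball_compact_fin_dim (R : realType) (X : finDimBanachType R)
    (r : R) : exists2 K : set X, compact K & [set x | `|x| <= r] `<=` K.
Proof.
pose n := \dim (fullv : {vspace X}).
pose e : n.-tuple X := vbasis fullv.
have eP : basis_of fullv e := vbasisP _.
pose f (v : 'rV[R]_n) : X := \sum_i v 0 i *: e`_i.
have fsurj x : f (\row_i coord e i x) = x.
  rewrite [RHS](coord_basis eP (memvf x)); apply: eq_bigr => i _.
  by rewrite mxE.
have f0 v : f v = 0 -> v = 0.
  move=> fv0; apply/rowP => i; rewrite mxE.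
  by have /freeP/(_ (fun i => v 0 i) fv0)-> := basis_free eP.
have fZ k v : f (k *: v) = k *: f v.
  by rewrite /f scaler_sumr; apply: eq_bigr => i _; rewrite mxE scalerA.
have cf : continuous f.
  apply: (continuous_big add_continuous) => i _ v.
  by apply: cvgZr_tmp; [exact: nbhs_filter|exact: coord_continuous].
have [m m0 fm] := rV_norm_lower_bound _ _ _ _ fZ f0 cf.
exists (f @` [set v | `|v| <= r / m]).
  apply: continuous_compact; first exact: continuous_subspaceT.
  apply: bounded_closed_compact.
    exists (r / m); split; first exact: num_real.
    by move=> M rM v /= /le_trans; apply; exact: ltW.
  have -> : [set v : 'rV[R]_n | `|v| <= r / m] =
    (fun v => `|v|) @^-1` [set x | x <= r / m] by [].
  by apply: closed_comp => [v _|]; [exact: norm_continuous|exact: closed_le].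
move=> x /= xr; exists (\row_i coord e i x); rewrite ?fsurj//=.
by rewrite ler_pdivlMr// mulrC (le_trans (fm _))// fsurj.
Qed.

(** Finitely many balls of radius [a / 2] cover the image of [A], and each of them catches at most
    one element of [A]. *)
Lemma separated_bounded_finite (R : realType) (X : finDimBanachType R)
    (T : Type) (f : T -> X) (a r : R) (A : set T) : 0 < a ->
  (forall x y, A x -> A y -> x <> y -> a <= `|f x - f y|) ->
  (forall x, A x -> `|f x| <= r) -> finite_set A.
Proof.
move=> a0 sepA Ar; have [K cK rK] := closed_ball_compact_fin_dim _ X r.
move: cK; rewrite compact_cover => /(_ X K (fun c => ball c (a / 2))).
case=> [c _|x Kx|D _ KD].
- exact: ball_open.
- by exists x => //; apply: ballxx; rewrite divr_gt0.
have -> : A = \bigcup_(c in [set` D]) (A `&` f @^-1` ball c (a / 2)).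
  apply/seteqP; split=> [x Ax|x [c _ []//]].
  by have [c Dc xc] := KD _ (rK _ (Ar _ Ax)); exists c.
apply: bigcup_finite => // c _.
have [[x [Ax xc]]|/set0P/negP/negPn/eqP->] :=
  pselect ((A `&` f @^-1` ball c (a / 2)) !=set0); last exact: finite_set0.
apply: (sub_finite_set _ (finite_set1 x)) => y [Ay yc].
apply: contrapT => yx; have := sepA _ _ Ay Ax yx.
have := ball_triangle (ball_sym yc) xc.
by rewrite -splitr -ball_normE /= => h /(lt_le_trans h); rewrite ltxx.
Qed.

(** * Retractions of a rooted tree with finite levels *)

(** Greedy enumeration: each step lists an element of least level among those not yet listed. *)
Lemma level_enumeration (T : choiceType) (l : T -> nat) (o : T) :
  l o = 0%N -> (forall x, l x = 0%N -> x = o) ->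
  (forall k, finite_set [set x | (l x <= k)%N]) ->
  exists x : nat -> T,
  [/\ forall n, (x @` `I_n.+1) o,
      \bigcup_j [set x j] = [set: T] &
      forall n y z, (x @` `I_n.+1) y -> (l z < l y)%N -> (x @` `I_n.+1) z].
Proof.
move=> lo l0 lfin.
have /choice[next nextP] (s : seq T) : exists z, forall y, y \notin s ->
    z \notin s /\ (l z <= l y)%N.
  (* Once [T] is exhausted, [o] is repeated forever, which covers finite [T]. *)
  have [[y ys]|none] := pselect (exists y, y \notin s); last first.
    by exists o => y ys; case: none; exists y.
  have exk : exists k, `[< exists2 z, z \notin s & l z = k >].
    by exists (l y); apply/asboolP; exists y.
  have [k /asboolP[z zs lz] kmin] := ex_minnP exk.
  exists z => w ws; split=> //; rewrite lz; apply: kmin.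
  by apply/asboolP; exists w.
pose S := fix S n := if n is m.+1 then rcons (S m) (next (S m)) else [:: o].
pose x n := if n is m.+1 then next (S m) else o.
have xS n : x @` `I_n.+1 = [set` S n].
  elim: n => [|n IH] /=; apply/seteqP; split=> [y|y].
  - by case=> -[|//] _ <-; rewrite /= inE.
  - by rewrite /= inE => /eqP->; exists 0%N.
  - move=> [i]; rewrite /= mem_rcons inE ltnS leq_eqVlt => /orP[/eqP->|ilt] <-.
      by rewrite eqxx.
    suff : [set` S n] (x i) by move=> /= ->; rewrite orbT.
    by rewrite -IH; exists i.
  - rewrite /= mem_rcons inE => /orP[/eqP->|yS]; first by exists n.+1 => /=.
    have : [set` S n] y by [].
    by rewrite -IH => -[i /= ilt <-]; exists i => //=; exact: ltnW.
exists x; split=> [n||n y z].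
- by exists 0%N.
- apply/seteqP; split=> // z _; apply: contrapT => zx.
  have {zx} zS n : z \notin S n.
    apply/negP => zS; have : [set` S n] z by [].
    by rewrite -xS => -[i _ xi]; apply: zx; exists i.
  (* As long as [z] is missing, every step lists a new element of level at most [l z]; after
     [size s] steps there are more of them than the list [s] can hold. *)
  have [s sE] := (finite_seqP _).1 (lfin (l z)).
  have uS n : uniq (S n) /\ {subset S n <= s}.
    elim: n => [|n [un sn]].
      split=> // y; rewrite inE => /eqP->.
      by have : [set` s] o by rewrite -sE /= lo.
    have [nS ln] := nextP _ _ (zS n).
    split; first by rewrite /= rcons_uniq nS.
    move=> y; rewrite /= mem_rcons inE => /orP[/eqP->|/sn//].
    by have : [set` s] (next (S n)) by rewrite -sE.
  have := uniq_leq_size (uS (size s)).1 (uS (size s)).2.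
  suff -> : forall n, size (S n) = n.+1 by rewrite ltnn.
  by elim=> // n IH; rewrite /= size_rcons IH.
- rewrite !xS; elim: n => [|n IH] /=.
    by rewrite inE => /eqP->; rewrite lo ltn0.
  rewrite !mem_rcons !inE => /orP[/eqP->|yS] lzy; last by rewrite IH ?orbT.
  apply/orP; right; apply: contraTT lzy => zS.
  by rewrite -leqNgt; exact: (nextP _ _ zS).2.
Qed.

Section FirstAncestor.
Variables (T : Type) (par : T -> T).

Definition first_ancestor (A : set T) (y w : T) :=
  exists i, [/\ w = iter i par y, A w &
    forall j, (j < i)%N -> ~ A (iter j par y)].

Lemma first_ancestor_ex (A : set T) y k :
  A (iter k par y) -> exists w, first_ancestor A y w.
Proof.
move=> Ak; have ex : exists k, `[< A (iter k par y) >].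
  by exists k; apply/asboolP.
have [i /asboolP Ai imin] := ex_minnP ex.
exists (iter i par y), i; split=> // j ji Aj.
by move: ji; rewrite ltnNge imin//; exact/asboolP.
Qed.

Lemma first_ancestor_uniq (A : set T) y w w' :
  first_ancestor A y w -> first_ancestor A y w' -> w = w'.
Proof.
move=> [i [-> Ai imin]] [j [-> Aj jmin]].
by have [/jmin//|/imin//|->] := ltngtP i j.
Qed.

(** The path from [y] to the root meets [B] no later than [A], so the search for [A] may pause at
    [B]. This is what makes the retractions commute. *)
Lemma first_ancestor_trans (A B : set T) y w v : A `<=` B ->
  first_ancestor B y w -> first_ancestor A w v -> first_ancestor A y v.
Proof.
move=> AB [i [-> Bi imin]] [j [-> Aj jmin]]; exists (j + i)%N.
split; [by rewrite iterD|by []|move=> k kji Ak].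
have [ki|ik] := ltnP k i; first exact/(imin _ ki)/AB.
apply: (jmin (k - i)%N); first by rewrite ltn_subLR// addnC.
by rewrite -iterD subnK.
Qed.

End FirstAncestor.

(** The last clause says that [phi n] truncates levels at [m], the largest level among the first
    points, up to an error of one: level [m] may be only partly listed, while all lower levels are
    complete. *)
Lemma tree_retractions (T : choiceType) (l : T -> nat) (par : T -> T) (o : T) :
  (forall x, l (par x) = (l x).-1) ->
  l o = 0%N -> (forall x, l x = 0%N -> x = o) ->
  (forall k, finite_set [set x | (l x <= k)%N]) ->
  exists (x : nat -> T) (phi : nat -> T -> T),
  [/\ forall n, retraction_onto (phi n) (x @` `I_n.+1),
      \bigcup_j [set x j] = [set: T],
      forall m n, phi m \o phi n = phi (minn m n) &
      forall n, exists m, forall y, exists i,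
        [/\ phi n y = iter i par y, (l y - i <= m)%N
          & (minn (l y) m <= (l y - i).+1)%N]].
Proof.
move=> lpar lo l0 lfin.
have [x [xo xT xdown]] := level_enumeration _ _ _ lo l0 lfin.
have liter i y : l (iter i par y) = (l y - i)%N.
  by elim: i => [|i IH] /=; rewrite ?subn0// lpar IH subnS.
have phi_ex n y : exists w, first_ancestor _ par (x @` `I_n.+1) y w.
  apply: (first_ancestor_ex _ _ _ _ (l y)).
  by rewrite (l0 (iter _ _ _)) ?liter ?subnn.
pose phi n y := projT1 (cid (phi_ex n y)).
have phiP n y : first_ancestor _ par (x @` `I_n.+1) y (phi n y).
  exact: projT2 (cid (phi_ex n y)).
have phi_id n y : (x @` `I_n.+1) y -> phi n y = y.
  by move=> xy; apply: first_ancestor_uniq (phiP n y) _; exists 0%N.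
have phi_im n y : (x @` `I_n.+1) (phi n y) by case: (phiP n y) => i [].
exists x, phi; split=> // [n|m n|n].
- split; last exact: phi_id.
  apply/seteqP; split=> [_ [y _ <-]|y xy]; first exact: phi_im.
  by exists y => //; exact: phi_id.
- apply/funext => y /=; have [mn|nm] := leqP m n.
    apply: first_ancestor_uniq (phiP m y).
    apply: first_ancestor_trans (phiP n y) (phiP m _).
    by apply: image_subset => i /= im; apply: (leq_trans im).
  rewrite phi_id//; have [i /= il <-] := phi_im n y.
  by exists i => //=; exact: ltnW (leq_trans il nm).
- exists (\max_(i < n.+1) l (x i))%N => y.
  case: (phiP n y) => i [phiE phiA imin]; exists i; split=> //.
    rewrite -liter -phiE; have [j jn <-] := phiA.
    exact: (leq_bigmax_cond (F := fun i => l (x (nat_of_ord i))) (Ordinal jn)).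
  (* Either [y] is fixed, or the last ancestor skipped is unlisted and so has level at least [m]. *)
  case: i imin {phiE} => [|i] imin; first by rewrite subn0 geq_min leqnSn.
  rewrite geq_min; apply/orP; right; apply/bigmax_leqP => j _.
  rewrite subnS; apply: leq_trans (leqSpred _).
  rewrite -liter leqNgt; apply/negP => lij.
  by apply: (imin i (ltnSn i)); apply: xdown lij; exists j => /=.
Qed.

(** * Separated sets of directions and radial truncation *)

(** A maximal [e]-separated subset, given by Zorn's lemma, is [e]-dense: a point far from it could
    be added. *)
Lemma separated_net (R : realType) (V : normedModType R) (e : R) (S : set V) :
  0 < e -> exists A : set V,
  [/\ A `<=` S, forall x y, A x -> A y -> `|x - y| < e -> x = y &
      forall u, S u -> exists2 z, A z & `|z - u| < e].
Proof.
move=> e0; pose P (A : set V) :=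
  A `<=` S /\ forall x y, A x -> A y -> `|x - y| < e -> x = y.
have [F FP Ftot|A [[AS sepA] Amax]] := @Zorn_bigcup V P.
  split=> [x [A FA Ax]|x y [A FA Ax] [B FB By]]; first exact: (FP A FA).1.
  have [AB|BA] := Ftot _ _ FA FB.
    by apply: (FP _ FB).2 => //; exact: AB.
  by apply: (FP _ FA).2 => //; exact: BA.
exists A; split=> // u Su; apply: contrapT => Au.
have {}Au z : A z -> ~ (`|z - u| < e) by move=> Az zu; apply: Au; exists z.
apply: (Amax (A `|` [set u])).
  split; first by move=> x Ax; left.
  by move=> /(_ u (or_intror erefl)) /Au; rewrite subrr normr0; apply.
split=> [x [/AS//|->//]|x y [Ax|->] [Ay|->]//].
- exact: sepA.
- by move=> /(Au _ Ax).
- by rewrite distrC => /(Au _ Ay).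
Qed.

(** [D k] rounds a unit vector to a maximal [2 ^- k]-separated set of directions; separation makes
    it idempotent. *)
Lemma dyadic_directions (R : realType) (V : normedModType R) :
  exists D : nat -> V -> V, forall k u, `|u| = 1 ->
  [/\ `|D k u| = 1, `|D k u - u| < 2 ^- k, D k (D k u) = D k u &
      forall w, `|w| = 1 -> `|D k u - D k w| < 2 ^- k -> D k u = D k w].
Proof.
have e0 k : 0 < 2 ^- k :> R by rewrite invr_gt0 exprn_gt0.
have /choice[A AP] k := separated_net _ _ _ [set u : V | `|u| = 1] (e0 k).
have /choice[D DP] (ku : nat * V) : exists z : V, `|ku.2| = 1 ->
    A ku.1 z /\ `|z - ku.2| < 2 ^- ku.1.
  have [u1|] := pselect (`|ku.2| = 1); last by exists 0.
  by have [_ _ /(_ _ u1)[z Az zu]] := AP ku.1; exists z.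
exists (fun k u => D (k, u)) => k u u1.
have [AS sepA _] := AP k.
have [ADu Duu] := DP (k, u) u1; have Du1 := AS _ ADu.
split=> // [|w w1].
  have [ADDu DDu] := DP (k, D (k, u)) Du1.
  exact: sepA.
by apply: sepA => //; exact: (DP (k, w) w1).1.
Qed.

(** Polar form of the 2-Lipschitz bound for the radial retraction onto the ball of radius [r].
    Directions are normalized only at nonzero radius, since the root has none. *)
Lemma clamp_lipschitz (R : realType) (V : normedModType R) (s t r : R)
    (u v : V) : 0 <= s -> 0 <= t -> 0 <= r ->
  (s != 0 -> `|u| = 1) -> (t != 0 -> `|v| = 1) ->
  `|Num.min s r *: u - Num.min t r *: v| <= 2 * `|s *: u - t *: v|.
Proof.
move=> + + r0; wlog st : s t u v / s <= t => [wlg s0 t0 u1 v1|s0 t0 u1 v1].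
  have [st|/ltW ts] := leP s t; first exact: wlg.
  by rewrite distrC [X in _ * X]distrC; exact: wlg.
have [t_eq0|tN0] := eqVneq t 0.
  have -> : s = 0 by apply/le_anti; rewrite s0 -t_eq0 st.
  by rewrite t_eq0 min_l// !scale0r subr0 normr0 mulr0.
have {}v1 := v1 tN0.
have vst : `|(t - s) *: v| = t - s.
  by rewrite normrZ v1 mulr1 ger0_norm// subr_ge0.
have sZ : `|s *: u| = s.
  have [->|/u1 u1'] := eqVneq s 0; first by rewrite scale0r normr0.
  by rewrite normrZ u1' mulr1 ger0_norm.
have dst : t - s <= `|s *: u - t *: v|.
  rewrite distrC (le_trans _ (lerB_dist _ _))// sZ normrZ v1 mulr1.
  by rewrite ger0_norm.
(* If [s <= r < t], clamping moves the outer point by [t - r <= t - s], at most the distance. If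
   [r < s], compare at the common radius [s], at the cost of [t - s]. *)
have [sr|rs] := leP s r.
  have [tr|rt] := leP t r; first by rewrite ler_peMl// ler1n.
  have -> : s *: u - r *: v = (s *: u - t *: v) + (t - r) *: v.
    by rewrite scalerBl addrA subrK.
  apply: le_trans (ler_normD _ _) _; rewrite mulr2n mulrDl mul1r lerD2l.
  rewrite normrZ v1 mulr1 ger0_norm; last by rewrite subr_ge0 ltW.
  by apply: le_trans dst; rewrite lerD2l lerN2.
rewrite min_r ?(le_trans (ltW rs))//.
rewrite -scalerBr normrZ (ger0_norm r0).
apply: (@le_trans _ _ (s * `|u - v|)); first by rewrite ler_wpM2r// ltW.
rewrite -[s in s * _](ger0_norm s0) -normrZ.
have -> : s *: (u - v) = (s *: u - t *: v) + (t - s) *: v.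
  by rewrite scalerBl addrA subrK scalerBr.
apply: le_trans (ler_normD _ _) _; rewrite mulr2n mulrDl mul1r lerD2l.
by rewrite vst.
Qed.

(** * The radial skeleton and the tree built on it *)

(** Distinct radii differ by at least [h]; at equal radius [j.+1 * h], directions [2 ^- m] apart
    with [2 ^ m <= j.+1] give points at least [h] apart. *)
Lemma skeleton_separated (R : realType) (V : normedModType R)
    (D : nat -> V -> V) (h : R) (j k : nat) (z w : V) :
  (forall k u, `|u| = 1 -> forall w, `|w| = 1 ->
    `|D k u - D k w| < 2 ^- k -> D k u = D k w) ->
  0 < h -> `|z| = 1 -> D (trunc_log 2 j.+1) z = z ->
  `|w| = 1 -> D (trunc_log 2 k.+1) w = w ->
  `|(j.+1%:R * h) *: z - (k.+1%:R * h) *: w| < h -> (j, z) = (k, w).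
Proof.
move=> Dsep h0 z1 Dz w1 Dw.
have nZ i v : `|v| = 1 -> `|(i.+1%:R * h) *: v : V| = i.+1%:R * h.
  by move=> v1; rewrite normrZ v1 mulr1 ger0_norm// mulr_ge0// ltW.
have half i l : (i < l)%N -> (i.+1%:R * h + h <= l.+1%:R * h :> R).
  move=> il; rewrite -[X in _ + X]mul1r -mulrDl ler_pM2r//.
  by rewrite natr1 ler_nat.
have [jk|kj|jk] := ltngtP j k.
- move=> lth; exfalso.
  have := lerB_dist ((k.+1%:R * h) *: w) ((j.+1%:R * h) *: z).
  rewrite !nZ// distrC; have := half _ _ jk; lra.
- move=> lth; exfalso.
  have := lerB_dist ((j.+1%:R * h) *: z) ((k.+1%:R * h) *: w).
  rewrite !nZ//; have := half _ _ kj; lra.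
rewrite -jk in Dw *.
rewrite -scalerBr normrZ ger0_norm; last by rewrite mulr_ge0// ltW.
move=> lth; congr pair; rewrite -Dz -[RHS]Dw; apply: Dsep => //.
rewrite Dz Dw; set m := trunc_log 2 j.+1 in Dz Dw *.
have m0 : (0 : R) < 2 ^+ m by rewrite exprn_gt0.
rewrite -[X in _ < X]mulr1 mulrC ltr_pdivlMr//.
rewrite mulrAC gtr_pMl// in lth.
apply: le_lt_trans lth; rewrite mulrC ler_wpM2r//.
by rewrite -natrX ler_nat; apply: trunc_logP.
Qed.

Lemma trunc_log2_succ n : (0 < n)%N ->
  trunc_log 2 n.+1 = trunc_log 2 n \/ trunc_log 2 n.+1 = (trunc_log 2 n).+1.
Proof.
move=> n0; have le1 : (trunc_log 2 n <= trunc_log 2 n.+1)%N.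
  exact: leq_trunc_log.
have : (trunc_log 2 n.+1 <= (trunc_log 2 n).+1)%N.
  by rewrite -trunc_log2_double// leq_trunc_log// -addnn -addn1 leq_add2l.
rewrite leq_eqVlt ltnS => /orP[/eqP|le2]; first by right.
by left; apply/eqP; rewrite eqn_leq le2.
Qed.

(** [l x] and [u x] are approximate polar coordinates of [p x], with radial unit [3 * b]. The last
    bound keeps all ancestors of [x] near the ray of [u x]; its [13 * b] is [b] for rounding plus
    [4 * (3 * b)] for drift. *)
Lemma radial_tree (R : realType) (V : normedModType R) (T : choiceType)
    (p : T -> V) (b : R) : 0 < b -> injective p ->
  (forall v, exists x, `|p x - v| <= b) ->
  exists (l : T -> nat) (par : T -> T) (u : T -> V) (o : T),
  [/\ forall x, l (par x) = (l x).-1, l o = 0%N /\ forall x, l x = 0%N -> x = o,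
      forall x, l x <> 0%N -> `|u x| = 1,
      forall x, `|p x - ((l x)%:R * (3 * b)) *: u x| <= 3 * b &
      forall i x,
        `|p (iter i par x) - ((l x - i)%:R * (3 * b)) *: u x| <= 13 * b].
Proof.
move=> b0 pinj pdense; have [D DP] := dyadic_directions _ V.
have Dsep k u (u1 : `|u| = 1) w : `|w| = 1 ->
    `|D k u - D k w| < 2 ^- k -> D k u = D k w.
  by have [_ _ _] := DP k u u1; apply.
set h := 3 * b; have h0 : 0 < h by rewrite mulr_gt0.
(* Rounding fixes the points of the net exactly, so only the root can sit at 0 and every other point
   has a direction. *)
have /choice[rho rhoP] v :
    exists x, `|p x - v| <= b /\ forall y, p y = v -> x = y.
  have [[y yv]|nov] := pselect (exists y, p y = v).
    exists y; rewrite yv subrr normr0 ltW//; split=> // z.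
    by rewrite -yv => /pinj.
  have [x xv] := pdense v; exists x; split=> // y yv.
  by case: nov; exists y.
have rhob v : `|p (rho v) - v| <= b by case: (rhoP v).
have rho_near v w : rho v = rho w -> `|v - w| < h.
  move=> vw; have := ler_distD (p (rho v)) v w; rewrite (distrC v (p _)).
  have := rhob w; rewrite -vw; have := rhob v; rewrite /h.
  by have := b0; lra.
pose o := rho 0.
have p0 x : x <> o -> p x != 0.
  by move=> xo; apply/eqP => px; apply: xo; case: (rhoP 0) => _ /(_ _ px).
(* The index is shifted: (j, z) stands for the skeleton point at radius
   (j + 1) h, which keeps the root rho 0 out of the skeleton. *)
pose skel j z := `|z| = 1 /\ D (trunc_log 2 j.+1) z = z.
pose pt j (z : V) := rho ((j.+1%:R * h) *: z).
have ptN j z : `|z| = 1 -> pt j z <> o.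
  move=> z1 /rho_near; rewrite subr0 normrZ z1 mulr1 ger0_norm.
    by rewrite ltNge ler_peMl ?ler1n//; exact: ltW.
  by rewrite mulr_ge0// ltW.
(* A point off the skeleton is attached to the skeleton level just below it. *)
have /choice[c cP] x : exists q : nat * V,
    (x <> o -> `|q.2| = 1 /\ `|p x - (q.1.+1%:R * h) *: q.2| <= h) /\
    (forall j z, skel j z -> x = pt j z -> q = (j, z)).
  have [[[j z] /= [[z1 Dz] ->]]|nosk] :=
      pselect (exists q : nat * V, skel q.1 q.2 /\ x = pt q.1 q.2).
    exists (j, z); split=> [_|k w [w1 Dw] /rho_near].
      by split=> //; apply: le_trans (rhob _) _; rewrite /h; have := b0; lra.
    exact: (skeleton_separated _ _ D h j k z w).
  exists (Num.trunc (`|p x| / h), `|p x|^-1 *: p x); split=> [xo|j z sk xz].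
    have px0 : `|p x| != 0 by rewrite normr_eq0; exact: p0.
    split=> /=; first by rewrite normrZ normfV normr_id mulVf.
    have /truncn_itv : 0 <= `|p x| / h by rewrite divr_ge0// ltW.
    set m := Num.trunc _ => /andP[mle ltm].
    rewrite ler_pdivlMr// in mle; rewrite ltr_pdivrMr// in ltm.
    rewrite scalerA -[X in X - _]scale1r -scalerBl normrZ.
    rewrite -[X in _ * X](normr_id (p x)) -normrM mulrBl mul1r divfK//.
    rewrite distrC ger0_norm; last by rewrite subr_ge0 ltW.
    move: mle; rewrite -natr1 mulrDl mul1r; lra.
  by case: nosk; exists (j, z).
(* The parent lies one unit further in, with its direction rounded for the shell of its own radius.
   At level 1 that radius is 0 and the parent is [rho 0], the root. *)
pose l x := if x == o then 0%N else (c x).1.+1.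
pose par x := if x == o then o else
  rho (((c x).1%:R * h) *: D (trunc_log 2 (c x).1) (c x).2).
have parE x : x <> o -> par x =
    rho (((c x).1%:R * h) *: D (trunc_log 2 (c x).1) (c x).2).
  by move=> /eqP/negbTE xo; rewrite /par xo.
have lE x : x <> o -> l x = (c x).1.+1.
  by move=> /eqP/negbTE xo; rewrite /l xo.
have lo : l o = 0%N by rewrite /l eqxx.
have paro : par o = o by rewrite /par eqxx.
have ptE j z : skel j z -> [/\ c (pt j z) = (j, z), l (pt j z) = j.+1 &
    par (pt j z) = rho ((j%:R * h) *: D (trunc_log 2 j) z)].
  move=> sk; have /ptN po := sk.1.
  have cE : c (pt j z) = (j, z) by case: (cP (pt j z)) => _; apply.
  by rewrite lE// parE// cE.
have lpar x : l (par x) = (l x).-1.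
  have [->|/eqP xo] := eqVneq x o; first by rewrite paro lo.
  rewrite parE// (lE x)//=; have [u1 _] := (cP x).1 xo.
  case: (c x).1 => [|j]; first by rewrite mul0r scale0r.
  have [D1 _ DD _] := DP (trunc_log 2 j.+1) _ u1.
  by have [|_ ->] := ptE j (D (trunc_log 2 j.+1) (c x).2).
have l0 x : l x = 0%N -> x = o.
  by rewrite /l; case: eqP.
have liter i x : l (iter i par x) = (l x - i)%N.
  by elim: i => [|i IH] /=; rewrite ?subn0// lpar IH subnS.
pose u x := (c x).2.
have near_u x : `|p x - ((l x)%:R * h) *: u x| <= h.
  have [->|/eqP xo] := eqVneq x o.
    rewrite lo mul0r scale0r; apply: le_trans (rhob _) _.
    by rewrite /h; have := b0; lra.
  by rewrite lE//; case: (cP x) => /(_ xo)[].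
(* Every proper ancestor before the root is a skeleton point, and the drift of its direction is
   controlled by its own shell alone. *)
have iterP x i : x <> o -> (i < (c x).1)%N ->
    exists z, [/\ skel ((c x).1 - i).-1 z,
      iter i.+1 par x = pt ((c x).1 - i).-1 z &
      `|z - u x| <= 2 * 2 ^- trunc_log 2 ((c x).1 - i)].
  move=> xo; have [u1 _] := (cP x).1 xo.
  elim: i => [|i IH] iJ.
    rewrite subn0; have [D1 Du DD _] := DP (trunc_log 2 (c x).1) _ u1.
    exists (D (trunc_log 2 (c x).1) (c x).2); rewrite /skel prednK//.
    split=> //; first by rewrite /= parE// /pt prednK.
    by apply: le_trans (ltW Du) _; rewrite ler_peMl ?ler1n.
  have [|z [[z1 Dz] xz zu]] := IH; first exact: ltnW.
  have [k kE] : exists k, ((c x).1 - i)%N = k.+2.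
    by exists ((c x).1 - i).-2; move: iJ; case: (c x).1 => // J; lia.
  rewrite subnS; rewrite kE /= in xz zu Dz *.
  have [D1 Du DD _] := DP (trunc_log 2 k.+1) _ z1.
  exists (D (trunc_log 2 k.+1) z); split=> //.
    rewrite /= xz; by have [] := ptE k.+1 z (conj z1 Dz).
  (* Within a shell the direction no longer changes, by idempotence. On entering shell [m] from
     shell [m + 1], the old drift [2 * 2 ^- (m + 1)] and the new rounding [2 ^- m] add up to
     [2 * 2 ^- m]. *)
  have [lg|lg] := @trunc_log2_succ k.+1 isT; rewrite lg in Dz zu.
    by rewrite Dz.
  apply: le_trans (ler_distD z _ _) _; rewrite mulr2n mulrDl !mul1r.
  apply: lerD; first exact: ltW.
  apply: le_trans zu _; rewrite exprS invfM mulrA divff// mul1r.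
  exact: lexx.
exists l, par, u, o; split=> // [x lx|i x].
  have xo : x <> o by move=> xo; apply: lx; rewrite xo.
  by have [] := (cP x).1 xo.
have [iJ|Ji] := ltnP i (l x); last first.
  rewrite (eqP (Ji : (_ - _ == 0)%N)) mul0r scale0r subr0.
  have -> : iter i par x = o by apply: l0; rewrite liter; apply/eqP.
  have := rhob 0; rewrite subr0 => /le_trans; apply; have := b0; lra.
case: i iJ => [_|i iJ].
  by rewrite subn0; apply: le_trans (near_u x) _; rewrite /h; have := b0; lra.
have xo : x <> o by move=> xo; move: iJ; rewrite xo lo.
rewrite lE// in iJ *; have [z [[z1 Dz] -> zu]] := iterP x i xo iJ.
rewrite subSS; have [k kE] : exists k, ((c x).1 - i)%N = k.+1.
  by exists ((c x).1 - i).-1; rewrite prednK// subn_gt0.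
rewrite kE /= in zu *.
apply: le_trans (ler_distD ((k.+1%:R * h) *: z) _ _) _.
have -> : 13 * b = b + 4 * h by rewrite /h; ring.
apply: lerD; first exact: rhob.
rewrite -scalerBr normrZ ger0_norm; last by rewrite mulr_ge0// ltW.
rewrite mulrAC ler_pM2r//.
apply: le_trans (ler_wpM2l _ zu) _ => //.
(* The drift is scaled by the radius [k.+1 * h], and [k.+1] is less than twice the power of 2 of its
   shell, whence [4 * h]. *)
rewrite mulrA ltW// ltr_pdivrMr ?exprn_gt0// -natrX -!natrM ltr_nat.
have := trunc_log_ltn k.+1 (isT : 1 < 2)%N; rewrite expnS; lia.
Qed.

(** * The Lipschitz estimate on the net *)

Theorem theorem2p6 (R : realType) (X : finDimBanachType R) (a b : R)
    (a_gt0 : 0 < a) (b_gt0 : 0 < b) (N : set X) (netN : is_net a b N) :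
  has_retractional_basis N
    ((2 * b / a + 1) * (4 * b / a + 1) * (156 * b / a + 2)).
Proof.
have [sepN densN] := netN; pose p (x : N) : X := set_val x.
have pinj : injective p by exact: val_inj.
have pdense (v : X) : exists x : N, `|p x - v| <= b.
  have [y Ny vy] := densN v.
  by exists (SigSub (mem_set Ny)); rewrite /p distrC.
have psep (x y : N) : x <> y -> a <= `|p x - p y|.
  move=> xy; apply: sepN; [exact: set_valP|exact: set_valP|].
  by move=> /pinj.
have [l [par [u [x0 [lpar [lo l0] u1 pl piter]]]]] :=
  radial_tree _ _ _ p b b_gt0 pinj pdense.
set h := 3 * b in pl piter; have h0 : 0 < h by rewrite mulr_gt0.
have lfin k : finite_set [set x | (l x <= k)%N].
  apply: (separated_bounded_finite _ X _ p a ((k%:R + 1) * h)) => //.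
    by move=> x y _ _; exact: psep.
  move=> x /= lxk.
  have := ler_distD (((l x)%:R * h) *: u x) (p x) 0.
  rewrite !subr0 => /le_trans; apply.
  rewrite mulrDl mul1r addrC; apply: lerD (pl x).
  have [lx0|lxN0] := eqVneq (l x) 0%N.
    by rewrite lx0 mul0r scale0r normr0 mulr_ge0// ltW.
  rewrite normrZ u1; last exact/eqP.
  rewrite mulr1 ger0_norm; last by rewrite mulr_ge0// ltW.
  by rewrite ler_pM2r// ler_nat.
have [x [phi [retr xT phiC phil]]] :=
  tree_retractions _ l par x0 lpar lo l0 lfin.
set K := (X in has_retractional_basis _ X).
have ba0 : 0 <= b / a by rewrite divr_ge0// ltW.
(* The first two factors of [K] are at least 1, so it suffices to reach the last one. *)
have K_ge : 156 * (b / a) + 2 <= K.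
  rewrite /K -!(mulrA _ b) ler_peMl//; first by lra.
  by rewrite mulr_ege1//; lra.
split.
- by rewrite -xT; apply: bigcup_countable => // i _; exact: countable1.
- by lra.
exists phi, x; split=> // n y z.
have [-> |/eqP yz] := eqVneq y z.
  by rewrite !mdistxx mulr0.
have [m mP] := phil n.
(* [q] is the radial retraction onto the ball of radius [m * h], applied to the polar approximation
   of a point. It differs from [phi n] by [13 * b] for the ancestor's position and [h] for the level
   error of one. *)
pose q y := Num.min ((l y)%:R * h) (m%:R * h) *: u y.
have pq w : `|p (phi n w) - q w| <= 13 * b + h.
  have [i [-> lim mil]] := mP w.
  apply: le_trans (ler_distD (((l w - i)%:R * h) *: u w) _ _) _.
  apply: lerD; first exact: piter.
  rewrite /q -minr_pMl; last exact: ltW.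
  rewrite -scalerBl -mulrBl normrZ.
  have [lw0|lwN0] := eqVneq (l w) 0%N.
    by rewrite lw0 sub0n min_l// subrr mul0r normr0 mul0r ltW.
  rewrite u1 ?mulr1; last exact/eqP.
  rewrite normrM (gtr0_norm h0) ger_pMl//.
  have wm : (minn (l w) m <= l w - i + 1)%N by rewrite addn1.
  have mw : (l w - i <= minn (l w) m + 1)%N by lia.
  have minE : Num.min (l w)%:R m%:R = (minn (l w) m)%:R :> R.
    by rewrite -natr_min -minEnat.
  rewrite minE; move: wm mw; rewrite -!(ler_nat R) !natrD ler_norml; lra.
have qq : `|q y - q z| <= 2 * (`|p y - p z| + 2 * h).
  have lh w : 0 <= (l w)%:R * h by rewrite mulr_ge0// ltW.
  have lu w : (l w)%:R * h != 0 -> `|u w| = 1.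
    move=> lN0; apply: u1 => lw0; move/eqP: lN0; apply.
    by rewrite lw0 mul0r.
  have mh : 0 <= m%:R * h by rewrite mulr_ge0// ltW.
  have := clamp_lipschitz _ _ _ _ _ _ _ (lh y) (lh z) mh (lu y) (lu z).
  move=> /le_trans; apply; rewrite ler_pM2l//.
  apply: le_trans (ler_distD (p y) _ _) _.
  have := ler_distD (p z) (p y) (((l z)%:R * h) *: u z).
  have := pl y; have := pl z; rewrite (distrC _ (p y)); lra.
have d_ge : a <= `|p y - p z| by exact: psep.
(* With [h = 3 * b], the additive error is [2 * (13 * b + h) + 4 * h = 44 * b]. *)
have tri : `|p (phi n y) - p (phi n z)| <= 2 * `|p y - p z| + 44 * b.
  apply: le_trans (ler_distD (q y) _ _) _.
  have := ler_distD (q z) (q y) (p (phi n z)).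
  have := pq y; have := pq z; rewrite (distrC (p _) (q z)); have := qq.
  rewrite /h; lra.
(* Separation turns the additive error into a multiplicative one. *)
have bd : b <= b / a * `|p y - p z|.
  by rewrite mulrAC ler_pdivlMr// ler_pM2l.
change (`|p (phi n y) - p (phi n z)| <= K * `|p y - p z|).
apply: le_trans tri _.
apply: (@le_trans _ _ ((156 * (b / a) + 2) * `|p y - p z|)).
  by rewrite (mulrDl (156 * (b / a))) -(mulrA 156); lra.
exact: ler_wpM2r.
Qed.
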